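(* Let $p>1$, $p'=\frac p{p-1}$. Let $f>0$ be lower semicontinuous in $(0,1)$, $f\in L^1(0,1)$, and let $h:[0,1]\to\mathbb{R}$ be continuous at $0$, bounded and piecewise continuous on $[0,1]$ (as specified in the context). Set $$0<\nu:=\liminf_{t\to0^+}\frac{f(t)}{t^{p'-1}}\quad(\nu=+\infty\text{ allowed}).$$ If $$h(0)<c<h(0)+(p')^{\frac1{p'}}p^{\frac1p}\nu^{\frac1{p'}},$$ then the boundary value problem $$y'(t)=p'\Big[(c-h(t))(y^+(t))^{\frac1p}-f(t)\Big],\ t\in(0,1),\qquad y(0)=0=y(1)$$ has no positive solution. In particular, if $\nu=+\infty$, then this problem has no positive solution for any $c>h(0)$.
   Context: $y^+=\max\{y,0\}$. A solution of the boundary value problem is meant in the sense of Carathéodory: an absolutely continuous function $y$ on $[0,1]$ satisfying the differential equation almost everywhere in $(0,1)$ and the boundary conditions. Positive means $y>0$ in $(0,1)$. Hypothesis on $h$: there are $0=k_0<k_1<\dots<k_q<k_{q+1}=1$ such that $h$ has a jump discontinuity at $k_j$ (finite one-sided limits), $j=1,\dots,q$, and $h|_{(k_j,k_{j+1})}$ is continuous, $j=0,\dots,q$; moreover $h$ is bounded on $[0,1]$ and continuous at $0$. *)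

(* Defs.v *)
From mathcomp Require Import all_boot all_order all_algebra.
From mathcomp Require Import all_classical all_reals all_analysis.

Set Implicit Arguments.
Unset Strict Implicit.
Unset Printing Implicit Defensive.

Import Order.TTheory GRing.Theory Num.Theory.
Import numFieldNormedType.Exports.

Local Open Scope classical_set_scope.
Local Open Scope ring_scope.

Definition conjugate_exponent (R : realType) (p : R) : R := p / (p - 1).

Definition absolutely_continuous (R : realType) (a b : R) (f : R -> R) : Prop :=
  forall e : R, 0 < e -> exists2 d : R, 0 < d &
    forall (n : nat) (u v : 'I_n -> R),
      (forall i, a <= u i /\ u i <= v i /\ v i <= b) ->
      trivIset [set: 'I_n] (fun i => `]u i, v i[%classic) ->
      \sum_(i < n) (v i - u i) < d ->
      \sum_(i < n) `|f (v i) - f (u i)| < e.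

(* The library's discontinuity is a jump: both one-sided limits exist in R and
   they differ. The case q = 0 is allowed, and nothing is required of the values
   of h at the points k_1, ..., k_q. *)
Definition piecewise_continuous01 (R : realType) (h : R -> R) : Prop :=
  exists (q : nat) (k : nat -> R),
    [/\ k 0%N = 0, k q.+1 = 1,
        (forall j, (j <= q)%N -> k j < k j.+1),
        (forall j, (1 <= j <= q)%N -> discontinuity h (k j)) &
        (forall j, (j <= q)%N -> {within `]k j, k j.+1[, continuous h})].

(* Points outside D are isolated in the topology of subspace D. *)
Definition lower_semicontinuous_on (R : realType) (D : set R) (f : R -> R)
  : Prop := lower_semicontinuous (EFin \o f : subspace D -> \bar R).

Definition liminf0 (R : realType) (p : R) (f : R -> R) : \bar R :=
  limf_einf (fun t : R => (f t / t `^ (conjugate_exponent p - 1))%:E) 0^'+.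

Definition positive_part (R : realType) (y : R) : R := Num.max y 0.

Definition bvp_solution (R : realType) (p c : R) (h f y : R -> R) : Prop :=
  [/\ absolutely_continuous 0 1 y,
      {ae @lebesgue_measure R, forall t : R, t \in `]0, 1[ ->
         is_derive t 1 y
           (conjugate_exponent p *
              ((c - h t) * positive_part (y t) `^ p^-1 - f t))},
      y 0 = 0 & y 1 = 0].

Definition positive_bvp_solution (R : realType) (p c : R) (h f y : R -> R)
  : Prop :=
  bvp_solution p c h f y /\ (forall t : R, t \in `]0, 1[ -> 0 < y t).

(* Main.v *)
Require Import Defs.
From mathcomp Require Import all_boot all_order all_algebra.
From mathcomp Require Import all_classical all_reals all_analysis.
From mathcomp Require Import ring lra.

Set Implicit Arguments.
Unset Strict Implicit.
Unset Printing Implicit Defensive.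

Import Order.TTheory GRing.Theory Num.Theory.
Import numFieldNormedType.Exports.

Local Open Scope classical_set_scope.
Local Open Scope ring_scope.

(** Everything happens near 0.  Write [p'] for the conjugate exponent and put
    [u = y^(1/p')].  Where [y > 0], the chain rule turns the equation into
    [u' = (c - h) - f / y^(1/p)], in which the power nonlinearity has become
    the constant term [c - h].

    Suppose that on some interval [(0, delta)] we have [c - h <= K] and
    [f >= m t^(p'-1)].  First, [u' <= K] gives [u(t) <= K t], so the slope
    [k = sup u(t)/t] is finite and positive.  Next, [u(t) <= k t] means
    [y^(1/p) = u^(p'-1) <= (k t)^(p'-1)], whence [u' <= K - m / k^(p'-1)],
    and integrating from 0 again gives [k <= K - m / k^(p'-1)], that is,
    [k^p' + m <= K k^(p'-1)].  Young's inequality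
    ([young_subcritical]) excludes this as soon as
    [K < (p')^(1/p') p^(1/p) m^(1/p')], and this is exactly the threshold of
    the theorem: when [c] lies strictly below it, there is room to choose
    [m < nu] ([exists_subcritical_weight]) and then [K > c - h 0] in between.

    The analytic input is that an absolutely continuous function whose
    derivative is almost everywhere at most [C] grows at rate at most [C]
    ([ac_increment_le]).  It is proved without integration: the
    exceptional null set is covered by an open set [U] of small measure, and
    [[a, b]] is traversed by small steps, which either stay near a point of
    differentiability or lie inside [U].  The total variation of the function
    over the latter is small by absolute continuity. *)

(** * Growth of absolutely continuous functions *)

(** Cousin's lemma (every gauge on [[a, b]] has a fine tagged partition) phrased
    as an induction principle: a step from [x] to [y] around the tag [z] may be
    as short as [z] requires.  The supremum of the points reached is itself a
    tag, and the step around it passes beyond it unless it is [b]. *)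
Lemma cousin_induction (R : realType) (a b : R) (P : R -> Prop) :
  a <= b -> P a ->
  (forall z, a <= z <= b -> exists2 r, 0 < r &
    forall x y, a <= x -> x <= z -> z <= y -> y <= b -> y - x < r ->
      P x -> P y) ->
  P b.
Proof.
move=> leab Pa step.
pose S := [set x | a <= x <= b /\ P x].
have Sa : S a by rewrite /S /= lexx leab.
have supS : has_sup S.
  by split; [exists a|exists b => x [/andP[]]].
have a_sup : a <= sup S by exact: sup_upper_bound.
have sup_b : sup S <= b by apply: ge_sup; [exists a|move=> x [/andP[]]].
have [|r r0 stepr] := step (sup S); first by rewrite a_sup.
have r40 : 0 < r / 4 by lra.
have [x [/andP[ax xb] Px] xsup] := sup_adherent r40 supS.
have xle : x <= sup S by apply: sup_upper_bound => //; split=> //; rewrite ax.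
have [ltb|geb] := ltP (sup S + r / 4) b.
- have Py : P (sup S + r / 4) by apply: stepr Px => //; lra.
  have : sup S + r / 4 <= sup S.
    by apply: sup_upper_bound => //; split=> //; lra.
  by lra.
- by apply: stepr Px => //; lra.
Qed.

(** The increment over [[x, y]] is split at [z], because the derivative at [z]
    only controls increments starting or ending at [z]. *)
Lemma is_derive_straddle (R : realType) (g : R -> R) (z D C e : R) :
  is_derive z 1 g D -> D <= C -> 0 < e ->
  exists2 r, 0 < r & forall x y, x <= z -> z <= y -> y - x < r ->
    g y - g x <= (C + e) * (y - x).
Proof.
move=> [dg Dg] DC e0.
have : h^-1 *: ((g \o shift z) (h *: 1) - g z) @[h --> 0^'] --> D.
  by rewrite -Dg; exact: dg.
move=> /cvgrPdist_lt /(_ e e0) [r /= r0 near_r].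
have slope w : w != z -> `|w - z| < r ->
    `|D - (w - z)^-1 * (g w - g z)| < e.
  move=> wz wr.
  have /near_r : ball_ Num.norm 0 r (w - z) by rewrite /= sub0r normrN.
  rewrite subr_eq0 => /(_ wz).
  by rewrite /= /GRing.scale /= mulr1 subrK.
exists r => // x y xz zy yxr.
have right : g y - g z <= (C + e) * (y - z).
  have [->|yz] := eqVneq y z; first by rewrite !subrr mulr0.
  have yz0 : 0 < y - z by rewrite subr_gt0 lt_neqAle eq_sym yz.
  have /slope : `|y - z| < r by rewrite gtr0_norm//; lra.
  move=> /(_ yz); rewrite ltr_norml => /andP[+ _].
  rewrite mulrC => H; rewrite -ler_pdivrMr//; lra.
have left : g z - g x <= (C + e) * (z - x).
  have [->|xz'] := eqVneq x z; first by rewrite !subrr mulr0.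
  have xz0 : 0 < z - x by rewrite subr_gt0 lt_neqAle xz'.
  have /slope : `|x - z| < r by rewrite distrC gtr0_norm//; lra.
  move=> /(_ xz'); rewrite ltr_norml => /andP[+ _].
  rewrite -[x - z]opprB -[g x - g z]opprB invrN mulrNN mulrC => H.
  rewrite -ler_pdivrMr//; lra.
by rewrite !mulrBr in left right *; lra.
Qed.

Lemma itv_family_length_le (R : realType) (U : set R) (d : R) n
    (u v : 'I_n -> R) :
  open U -> (lebesgue_measure U <= d%:E)%E ->
  (forall i, u i <= v i) -> (forall i, `]u i, v i[ `<=` U) ->
  trivIset [set: 'I_n] (fun i => `]u i, v i[%classic) ->
  \sum_(i < n) (v i - u i) <= d.
Proof.
move=> oU Ud uv uvU tI; rewrite -lee_fin; apply: le_trans Ud.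
have -> : (\sum_(i < n) (v i - u i))%:E =
    lebesgue_measure (\big[setU/set0]_(i < n) `]u i, v i[%classic : set R).
  rewrite measure_bigsetU_ord//; rewrite -sumEFin; apply: eq_bigr => i _.
  apply/esym/(eq_trans (lebesgue_measure_itv _)); rewrite /= lte_fin.
  case: ltP => [_|vu]; first by rewrite EFinB.
  by rewrite (@le_anti _ _ (v i) (u i)) ?subrr// vu uv.
apply: le_measure; rewrite ?inE.
- by apply: bigsetU_measurable.
- exact: measurable_realfun.open_measurable.
- by elim/big_ind: _ => [//|A B AU BU|i _]; [rewrite subUset; split|exact: uvU].
Qed.

(** The fundamental estimate for absolutely continuous functions.  In the
    induction along [[a, b]], the predicate [P x] records a chain of
    non-overlapping intervals inside the open set [U] covering the exceptional
    points, and pays for the growth of [g] over them by the variation of [g]. *)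
Lemma ac_increment_le (R : realType) (g : R -> R) (a b C : R) :
  a <= b -> absolutely_continuous a b g ->
  {ae @lebesgue_measure R, forall t : R, t \in `]a, b[ ->
    exists2 D, is_derive t 1 g D & D <= C} ->
  g b - g a <= C * (b - a).
Proof.
move=> leab acg aeg; apply/ler_addgt0Pr => e e0.
have ba0 : 0 < b - a + 2 by lra.
(* The error is [b - a] times [e'] from the straddling steps, plus [e'] each for
   the variation of [g] over the chain and for its length times [`|C|]. *)
pose e' := e / (b - a + 2).
have e'0 : 0 < e' by rewrite divr_gt0.
have [d d0 acd] := acg e' e'0.
(* A step inside [U]: its increment is charged to the chain.  The term
   [`|C| * (y - x)] compensates the allowance [C * (y - x)], negative when
   [C] is. *)
have absorb x y s : x <= y -> g x - g a <= (C + e') * (x - a) + s ->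
    g y - g a <=
      (C + e') * (y - a) + (s + (`|g y - g x| + `|C| * (y - x))).
  move=> xy gx; have gyx := ler_norm (g y - g x).
  have yx : 0 <= y - x by rewrite subr_ge0.
  have CC : 0 <= `|C| + C by rewrite -lerBlDr sub0r -normrN ler_norm.
  have e'yx := mulr_ge0 (ltW e'0) yx.
  have Cyx := mulr_ge0 CC yx.
  move: gx gyx e'yx Cyx; clear; rewrite !mulrBr !mulrDl; lra.
pose good := [set t | t \in `]a, b[ -> exists2 D, is_derive t 1 g D & D <= C].
(* The endpoints are added to the exceptional set, since nothing is known about
   the derivative there. *)
have /negligible_outer_measure N0 :
    (@lebesgue_measure R).-negligible (~` good `|` [set a; b]).
  apply: negligibleU => //; apply: negligibleU; apply/negligibleP => //;
  exact: lebesgue_measure_set1.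
pose d' := Num.min (d / 2) (e' / (`|C| + 1)).
have C0 : 0 <= `|C| by [].
have C10 : 0 < `|C| + 1 by lra.
have d'0 : 0 < d' by rewrite lt_min divr_gt0//= divr_gt0.
have [U [oU NU Ud]] := outer_measure_open_le (~` good `|` [set a; b]) d'0.
rewrite N0 add0e in Ud.
pose P x := exists n (u v : nat -> R),
  [/\ forall i, (i < n)%N -> [/\ a <= u i, u i <= v i & v i <= x],
      forall i, (i < n)%N -> `]u i, v i[ `<=` U,
      forall i j, (i < j < n)%N -> v i <= u j &
      g x - g a <= (C + e') * (x - a) +
        \sum_(i < n) (`|g (v i) - g (u i)| + `|C| * (v i - u i))].
have [n [u [v [uv uvU vu gb]]]] : P b.
  apply: (@cousin_induction _ a) => //.
    exists 0%N, (fun=> 0), (fun=> 0); split=> //.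
    by rewrite big_ord0 !subrr mulr0 addr0 lexx.
  move=> z /andP[az zb].
  have [Uz|nUz] := pselect (U z).
  - have [r /= r0 rU] := oU _ Uz.
    exists r => // x y ax xz zy yb yxr [n [u [v [uv uvU vu gx]]]].
    exists n.+1, (fun i => if (i < n)%N then u i else x),
      (fun i => if (i < n)%N then v i else y); split.
    + move=> i _; case: ltnP => [/uv[? ? ?]|_]; split=> //; lra.
    + move=> i _; case: ltnP => [/uvU//|_] w /=.
      rewrite in_itv/= => /andP[xw wy].
      by apply: rU => /=; rewrite ltr_norml; lra.
    + move=> i j /andP[ij]; rewrite ltnS => jn.
      rewrite (leq_trans ij jn); case: ltnP => [jn'|_].
        by apply: vu; rewrite ij.
      by have [] := uv _ (leq_trans ij jn).
    + rewrite big_ord_recr/= ltnn.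
      under eq_bigr do rewrite ltn_ord.
      exact: absorb (le_trans xz zy) gx.
  - have nN : ~ (~` good `|` [set a; b]) z by move/NU.
    have [gz zab] : good z /\ z != a /\ z != b.
      split; first by apply: contrapT => h; apply: nN; left.
      by split; apply/eqP => h; apply: nN; right; [left|right].
    have [|D gD DC] := gz.
      by rewrite in_itv/= !lt_neqAle az zb (eq_sym a) zab.1 zab.2.
    have [r r0 rg] := is_derive_straddle gD DC e'0.
    exists r => // x y ax xz zy yb yxr [n [u [v [uv uvU vu gx]]]].
    exists n, u, v; split=> //.
      by move=> i /uv[? ? ?]; split=> //; lra.
    have := rg _ _ xz zy yxr; rewrite !mulrBr in gx *; lra.
have tI : trivIset [set: 'I_n] (fun i : 'I_n => `]u i, v i[%classic).
  apply/trivIsetP => /= i j _ _.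
  wlog ij : i j / (i < j)%N.
    move=> wl; case: (ltngtP i j) => [ij|ji|/val_inj->]; last by rewrite eqxx.
      exact: wl.
    by rewrite setIC eq_sym; exact: wl.
  move=> _; rewrite -subset0 => w [] /=; rewrite !in_itv/= => /andP[_ wv].
  by have := vu i j; rewrite ij ltn_ord => /(_ isT) vu' /andP[uw _]; lra.
have len : \sum_(i < n) (v i - u i) <= d'.
  apply: itv_family_length_le Ud _ _ tI => // i.
    by have [] := uv i (ltn_ord i).
  exact: uvU.
have lend : \sum_(i < n) (v i - u i) < d.
  have : d' <= d / 2 by rewrite ge_min lexx.
  by move: len; lra.
have lenC : `|C| * \sum_(i < n) (v i - u i) <= e'.
  have : d' <= e' / (`|C| + 1) by rewrite ge_min lexx orbT.
  rewrite ler_pdivlMr// => d'e; apply: le_trans d'e; rewrite mulrC.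
  apply: ler_pM => //; last lra.
  by apply: sumr_ge0 => i _; rewrite subr_ge0; have [] := uv i (ltn_ord i).
have var : \sum_(i < n) `|g (v i) - g (u i)| <= e'.
  apply/ltW/(acd n (fun i => u i) (fun i => v i)) => // i.
  by have [] := uv i (ltn_ord i).
rewrite big_split/= -mulr_sumr in gb.
have -> : e = e' * (b - a + 2) by rewrite /e' divfK// gt_eqF.
by move: gb; lra.
Qed.

Lemma ac_subitv (R : realType) (a b a' b' : R) (g : R -> R) :
  a <= a' -> b' <= b -> absolutely_continuous a b g ->
  absolutely_continuous a' b' g.
Proof.
move=> aa' bb' acg e /acg[d d0 acd]; exists d => // n u v uv.
by apply: acd => i; have [? []] := uv i; lra.
Qed.

Lemma ac_modulus (R : realType) (a b : R) (g : R -> R) :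
  absolutely_continuous a b g -> forall e, 0 < e -> exists2 d, 0 < d &
    forall u v, a <= u -> u <= v -> v <= b -> v - u < d -> `|g v - g u| < e.
Proof.
move=> acg e /acg[d d0 acd]; exists d => // u v au uv vb vud.
have := acd 1%N (fun=> u) (fun=> v); rewrite !big_ord1; apply=> //.
by apply/trivIsetP => /= i j _ _; rewrite !ord1 eqxx.
Qed.

Lemma ac_within_continuous (R : realType) (a b : R) (g : R -> R) :
  absolutely_continuous a b g -> {within `[a, b], continuous g}.
Proof.
move=> acg; apply/subspace_continuousP => x /=.
rewrite in_itv/= => /andP[ax xb].
apply/cvgrPdist_lt => e e0; have [d d0 gd] := ac_modulus acg e0.
exists d => //= z; rewrite /= => xzd; rewrite in_itv/= => /andP[az zb].
have [xz|zx] := leP x z.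
  rewrite distrC; apply: gd => //.
  by move: xzd; rewrite distrC ger0_norm//; lra.
by apply: gd => //; [exact: ltW|move: xzd; rewrite gtr0_norm//; lra].
Qed.

(** For [q <= 1] the derivative of [x^q] decreases, so its value at the lower
    bound [l] is a Lipschitz constant on the half-line above [l]. *)
Lemma powR_lipschitz (R : realType) (q l x z : R) :
  0 <= q -> q <= 1 -> 0 < l -> l <= x -> l <= z ->
  `|x `^ q - z `^ q| <= q * l `^ (q - 1) * `|x - z|.
Proof.
move=> q0 q1 l0; wlog zx : x z / z <= x.
  move=> wl lx lz; have [/wl|/ltW/wl] := leP z x; first exact.
  by rewrite distrC (distrC x); exact.
move=> lx lz.
have der w : l <= w -> is_derive w 1 (fun x => x `^ q) (q * w `^ (q - 1)).
  by move=> lw; apply: is_derive1_powR; lra.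
have [||w] := @MVT_segment R (fun x => x `^ q)
  (fun w => q * w `^ (q - 1)) z x zx.
- by move=> w; rewrite in_itv/= => /andP[zw _]; apply: der; lra.
- apply: derivable_within_continuous => w; rewrite in_itv/= => /andP[zw _].
  by have [] := der w (le_trans lz zw).
rewrite in_itv/= => /andP[zw wx] ->.
have w0 : 0 < w by lra.
have lw : l <= w by lra.
rewrite ger0_norm; last first.
  by rewrite mulr_ge0 ?subr_ge0// mulr_ge0// powR_ge0.
rewrite ger0_norm ?subr_ge0// ler_wpM2r ?subr_ge0// ler_wpM2l//.
rewrite -opprB !powRN lef_pV2 ?posrE ?powR_gt0//.
by apply: ge0_ler_powR; rewrite ?nnegrE ?subr_ge0// ltW.
Qed.

(** Powers with exponent strictly between 0 and 1 have infinite slope at 0, but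
    by compactness [y] stays above a positive constant on [[a, b]]. *)
Lemma ac_powR (R : realType) (a b q : R) (y : R -> R) :
  a <= b -> 0 <= q -> q <= 1 -> (forall t, a <= t <= b -> 0 < y t) ->
  absolutely_continuous a b y ->
  absolutely_continuous a b (fun t => y t `^ q).
Proof.
move=> ab q0 q1 y0 acy.
have [t] := EVT_min ab (ac_within_continuous acy).
rewrite in_itv/= => /y0; set l := y t => l0 minl.
have lip s r : a <= s <= b -> a <= r <= b ->
    `|y s `^ q - y r `^ q| <= q * l `^ (q - 1) * `|y s - y r|.
  by move=> sab rab; apply: powR_lipschitz; rewrite ?minl ?in_itv.
set L := q * _ in lip.
have L0 : 0 <= L by rewrite mulr_ge0// powR_ge0.
move=> e e0; have eL0 : 0 < e / (L + 1) by rewrite divr_gt0//; lra.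
have [d d0 acd] := acy _ eL0.
exists d => // n u v uv tI uvd.
have := acd n u v uv tI uvd; rewrite ltr_pdivlMr; last lra.
apply: le_lt_trans; rewrite mulr_suml; apply: ler_sum => i _.
have [au [uv' vb]] := uv i.
apply: le_trans (lip _ _ _ _) _;
  rewrite ?au ?vb ?(le_trans au) ?(le_trans _ vb)//.
by rewrite mulrC ler_wpM2l//; lra.
Qed.

(** * The critical constant *)

Lemma conjugate_exponent_gt1 (R : realType) (p : R) :
  1 < p -> 1 < conjugate_exponent p.
Proof. by move=> p1; rewrite /conjugate_exponent ltr_pdivlMr; lra. Qed.

Lemma conjugate_exponentV (R : realType) (p : R) :
  1 < p -> (conjugate_exponent p)^-1 = 1 - p^-1.
Proof.
by move=> p1; rewrite /conjugate_exponent; field; apply/andP; split; lra.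
Qed.

Lemma conjugate_exponentB1 (R : realType) (p : R) :
  1 < p -> conjugate_exponent p - 1 = conjugate_exponent p / p.
Proof.
by move=> p1; rewrite /conjugate_exponent; field; apply/andP; split; lra.
Qed.

(** The upper bound on [K] is the sharp condition: by Young's inequality applied
    to [K / p^(1/p)] and [p^(1/p) k^(p'-1)], the minimum over [k] of
    [k^p' - K k^(p'-1)] is above [- m].  The factors are normalised so that
    the second Young term is exactly [k^p']. *)
Lemma young_subcritical (R : realType) (p K m k : R) :
  let p' := conjugate_exponent p in
  1 < p -> 0 <= K -> 0 < m -> 0 < k ->
  K < p' `^ p'^-1 * p `^ p^-1 * m `^ p'^-1 ->
  K * k `^ (p' - 1) < k `^ p' + m.
Proof.
move=> p' p1 K0 m0 k0 Klt.
have p0 : 0 < p by lra.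
have p'1 : 1 < p' by exact: conjugate_exponent_gt1.
have p'0 : 0 < p' by lra.
set P := p `^ p^-1 in Klt.
have P0 : 0 < P by rewrite powR_gt0.
have KPlt : (K / P) `^ p' < p' * m.
  have -> : p' * m = ((p' * m) `^ p'^-1) `^ p'.
    by rewrite -powRrM mulVf ?gt_eqF// powRr1// mulr_ge0// ltW.
  apply: gt0_ltr_powR; rewrite ?nnegrE ?powR_ge0 ?divr_ge0//; first exact: ltW.
  by rewrite ltr_pdivrMr// powRM ?ltW// mulrAC.
have kp : (P * k `^ (p' - 1)) `^ p = p * k `^ p'.
  rewrite powRM ?powR_ge0// -!powRrM mulVf ?gt_eqF// powRr1; last exact: ltW.
  by rewrite conjugate_exponentB1// divfK// gt_eqF.
have -> : K * k `^ (p' - 1) = K / P * (P * k `^ (p' - 1)).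
  by rewrite mulrA divfK// gt_eqF.
apply: le_lt_trans (conjugate_powR _ _ p'0 p0 _) _.
- by rewrite divr_ge0// ltW.
- by rewrite mulr_ge0 ?powR_ge0// ltW.
- by rewrite conjugate_exponentV// subrK.
rewrite kp mulrAC divff ?gt_eqF// mul1r addrC ltrD2l ltr_pdivrMr//.
by rewrite [m * p']mulrC.
Qed.

(** Strict inequality below the threshold for [nu] survives for some real weight
    [m < nu]; going through a real [m] treats finite and infinite [nu] alike. *)
Lemma exists_subcritical_weight (R : realType) (q A K : R) (nu : \bar R) :
  0 < q -> 0 < A -> 0 <= K -> (0 < nu)%E -> (K%:E < A%:E * nu `^ q^-1)%E ->
  exists m, [/\ 0 < m, (m%:E < nu)%E & K < A * m `^ q^-1].
Proof.
move=> q0 A0 K0; have qV0 : 0 < q^-1 by rewrite invr_gt0.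
have Kq m : 0 <= m -> (K / A) `^ q < m -> K < A * m `^ q^-1.
  move=> m0 /(gt0_ltr_powR qV0); rewrite !nnegrE powR_ge0 => /(_ isT m0).
  rewrite -powRrM divff ?gt_eqF// powRr1; last by rewrite divr_ge0// ltW.
  by rewrite ltr_pdivrMr// mulrC.
case: nu => [r||]//.
- rewrite lte_fin poweR_EFin -EFinM lte_fin => r0 Kr.
  have lt : (K / A) `^ q < r.
    rewrite -[r in _ < r]powRr1 ?ltW// -(@mulVf _ q) ?gt_eqF// powRrM.
    apply: gt0_ltr_powR; rewrite ?nnegrE ?powR_ge0 ?divr_ge0//; first exact: ltW.
    by rewrite ltr_pdivrMr// mulrC.
  have Kq0 := powR_ge0 (K / A) q.
  exists (((K / A) `^ q + r) / 2); rewrite lte_fin !midf_lt//; split=> //.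
    lra.
  by apply: Kq; [lra|rewrite midf_lt].
- move=> _ _; have Kq0 := powR_ge0 (K / A) q.
  exists ((K / A) `^ q + 1); split; [lra|exact: ltry|apply: Kq; lra].
Qed.

(** * Slope of the root of a solution at 0 *)

(** The left-hand side of the hypothesis is the derivative of [y^(1/p')].
    Absolute continuity passes from [y] to this root only away from the zeros of
    [y], so the growth estimate is applied on [[s, t]], and then [s] tends
    to 0. *)
Lemma root_le_linear (R : realType) (p c C delta : R) (f h y : R -> R) :
  1 < p -> positive_bvp_solution p c h f y -> delta <= 1 ->
  (forall t, 0 < t < delta -> c - h t - f t / y t `^ p^-1 <= C) ->
  forall t, 0 < t < delta -> y t `^ (conjugate_exponent p)^-1 <= C * t.
Proof.
move=> p1 [[acy aey y0 y1] ypos] d1 slope t /andP[t0 td].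
have p'1 := conjugate_exponent_gt1 p1; set p' := conjugate_exponent p in p'1 *.
have p'0 : 0 < p' by lra.
have p0 : 0 < p by lra.
have q0 : 0 < p'^-1 by rewrite invr_gt0.
have q1 : p'^-1 <= 1 by rewrite invf_le1// ltW.
have yp s : 0 < s -> s < 1 -> 0 < y s.
  by move=> s0 s1; apply: ypos; rewrite in_itv/= s0.
pose u s := y s `^ p'^-1.
have incr s : 0 < s -> s < t -> u t - u s <= C * (t - s).
  move=> s0 st; apply: ac_increment_le; first exact: ltW.
    apply: ac_powR (ltW st) (ltW q0) q1 _ _.
      by move=> w /andP[sw wt]; apply: yp; lra.
    by apply: ac_subitv acy; lra.
  apply: negligibleS aey; apply: subsetC => w /= dy.
  rewrite in_itv/= => /andP[sw wt].
  have w0 : 0 < w by lra.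
  have w1 : w < 1 by lra.
  have yw := yp _ w0 w1.
  have := dy; rewrite in_itv/= w0 w1 => /(_ isT) {}dy.
  have du := @is_derive1_comp R (fun x => x `^ p'^-1) y w _ _
    (is_derive1_powR _ yw) dy.
  eexists; first exact: du.
  have := slope w; rewrite w0 (lt_trans wt td) => /(_ isT); apply: le_trans.
  rewrite /positive_part max_l; last exact: ltW.
  rewrite (_ : p'^-1 - 1 = - p^-1); last by rewrite conjugate_exponentV//; ring.
  rewrite powRN -/p' le_eqVlt; apply/orP; left; apply/eqP.
  by field; rewrite !gt_eqF// powR_gt0.
apply/ler_addgt0Pr => e e0.
have e20 : 0 < (e / 2) `^ p' by rewrite powR_gt0; lra.
have [d d0 yd] := ac_modulus acy e20.
have C0 : 0 <= `|C| by [].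
have eC : 0 < e / 2 / (`|C| + 1) by rewrite divr_gt0//; lra.
pose s := Num.min (d / 2) (Num.min (t / 2) (e / 2 / (`|C| + 1))).
have s0 : 0 < s by rewrite !lt_min; apply/and3P; split=> //; lra.
have sd : s <= d / 2 by rewrite /s ge_min lexx.
have st : s <= t / 2 by rewrite /s !ge_min lexx orbT.
have sC : s <= e / 2 / (`|C| + 1) by rewrite /s !ge_min lexx !orbT.
(* [s] is so small that [y s] is below [(e / 2)^p'], whose root is [e / 2]. *)
have us : u s <= e / 2.
  have -> : e / 2 = ((e / 2) `^ p') `^ p'^-1.
    by rewrite -powRrM divff ?gt_eqF// powRr1; lra.
  have ys := yp s s0 ltac:(lra).
  apply: ge0_ler_powR; rewrite ?nnegrE ?powR_ge0 ?ltW//.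
  have := yd 0 s; rewrite y0 !subr0 gtr0_norm// => H; apply: H; lra.
have Cs : - (C * s) <= e / 2.
  apply: le_trans (ler_norm _) _; rewrite normrN normrM (gtr0_norm s0).
  by move: sC; rewrite ler_pdivlMr; last lra; rewrite mulrDr mulr1 mulrC; lra.
have := incr s s0; rewrite mulrBr -/(u t).
by move: us Cs st t0; clear; lra.
Qed.

(** Bootstrap on the supremum [k] of [u t / t]: the crude bound [K] shows that
    it is finite, and feeding [u t <= k * t] back into the equation improves
    [k] to [K - m / k^(p'-1)], which is incompatible with
    [young_subcritical]. *)
Lemma no_positive_solution_near0 (R : realType) (p c K m delta : R)
    (f h y : R -> R) :
  let p' := conjugate_exponent p in
  1 < p -> 0 < m -> K < p' `^ p'^-1 * p `^ p^-1 * m `^ p'^-1 ->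
  0 < delta -> delta <= 1 ->
  (forall t, 0 < t < delta -> c - h t <= K) ->
  (forall t, 0 < t < delta -> m * t `^ (p' - 1) <= f t) ->
  ~ positive_bvp_solution p c h f y.
Proof.
move=> p' p1 m0 Klt d0 d1 hK fm sol.
have p'1 : 1 < p' by exact: conjugate_exponent_gt1.
have p'0 : 0 < p' by lra.
have yp t : 0 < t < delta -> 0 < y t.
  by move=> /andP[t0 td]; apply: sol.2; rewrite in_itv/= t0; lra.
pose u t := y t `^ p'^-1.
have up t : 0 < t < delta -> 0 < u t by move=> /yp; exact: powR_gt0.
have uK t : 0 < t < delta -> u t <= K * t.
  apply: root_le_linear (p1) sol d1 _ _ => {}t td.
  apply: le_trans (hK t td); rewrite gerBl divr_ge0 ?powR_ge0//.
  by apply: le_trans (fm t td); rewrite mulr_ge0 ?powR_ge0// ltW.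
pose E := [set u t / t | t in [set t | 0 < t < delta]].
have d2 : 0 < delta / 2 < delta by apply/andP; split; lra.
have Ed2 : E (u (delta / 2) / (delta / 2)) by exists (delta / 2).
have supE : has_sup E.
  split; first by eexists; exact: Ed2.
  exists K => _ [t td <-]; rewrite ler_pdivrMr ?uK//; by case/andP: td.
pose k := sup E.
have uk t : 0 < t < delta -> u t <= k * t.
  move=> td; have /andP[t0 _] := td; rewrite -ler_pdivrMr//.
  by apply: sup_upper_bound => //; exists t.
have k0 : 0 < k.
  have /andP[d20 _] := d2.
  by have := lt_le_trans (up _ d2) (uk _ d2); rewrite pmulr_lgt0.
have kp : 0 < k `^ (p' - 1) by rewrite powR_gt0.
have K0 : 0 <= K.
  have /andP[d20 _] := d2.
  by have := lt_le_trans (up _ d2) (uK _ d2); rewrite pmulr_lgt0// => /ltW.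
have kle : k <= K - m / k `^ (p' - 1).
  apply: ge_sup; first by eexists; exact: Ed2.
  move=> _ [t td <-]; rewrite ler_pdivrMr; last by case/andP: td.
  apply: root_le_linear (p1) sol d1 _ _ td => {}t td.
  have /andP[t0 _] := td.
  have yq : y t `^ p^-1 = u t `^ (p' - 1).
    rewrite /u -powRrM mulrBr mulr1 mulVf ?gt_eqF// conjugate_exponentV//.
    by rewrite opprB addrC subrK.
  have uq : u t `^ (p' - 1) <= k `^ (p' - 1) * t `^ (p' - 1).
    rewrite -powRM; [|exact: ltW|exact: ltW].
    apply: ge0_ler_powR; rewrite ?nnegrE ?uk//; first lra.
      exact/ltW/up.
    by apply/ltW/mulr_gt0.
  apply: lerB; first exact: hK.
  have tp : 0 < t `^ (p' - 1) by rewrite powR_gt0.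
  rewrite ler_pdivlMr; last by rewrite powR_gt0// yp.
  rewrite yq; apply: le_trans (fm t td).
  rewrite mulrAC ler_pdivrMr// -mulrA ler_wpM2l//; first exact: ltW.
  by rewrite mulrC.
have := young_subcritical p1 K0 m0 k0 Klt.
rewrite -/p' ltNge => /negP; apply.
rewrite -mulr_powRB1; [|exact: ltW|exact: p'0].
move: kle; rewrite lerBrDr -(ler_pM2r kp) mulrDl divfK// gt_eqF//.
Qed.

Lemma liminf0_lb (R : realType) (p m : R) (f : R -> R) :
  (m%:E < liminf0 p f)%E ->
  \forall t \near 0^'+, m * t `^ (conjugate_exponent p - 1) <= f t.
Proof.
rewrite /liminf0 limf_einfE => /ereal_sup_gt [_ [V V0 <-]] mV.
near=> t; rewrite -ler_pdivlMr; last first.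
  by rewrite powR_gt0//; near: t; exact: nbhs_right_gt.
rewrite -lee_fin; apply: le_trans (ltW mV) _; apply: ereal_inf_lbound.
by exists t => //; near: t; exact: V0.
Unshelve. all: by end_near.
Qed.

(** * Nonexistence *)

Theorem theorem4p2 (R : realType) (p : R) (f h : R -> R)
    (p_gt1 : 1 < p)
    (f_gt0 : forall t : R, t \in `]0, 1[ -> 0 < f t)
    (f_lsc : lower_semicontinuous_on `]0, 1[ f)
    (f_L1 : (@lebesgue_measure R).-integrable `]0, 1[ (EFin \o f))
    (h_cont0 : h t @[t --> 0^'+] --> h 0)
    (h_bounded : [bounded h t | t in `[0, 1]])
    (h_pc : piecewise_continuous01 h)
    (nu_gt0 : (0 < liminf0 p f)%E) :
  let p' := conjugate_exponent p in
  let nu := liminf0 p f in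
  (forall c : R,
     ((h 0)%:E < c%:E)%E ->
     (c%:E < (h 0)%:E + (p' `^ p'^-1 * p `^ p^-1)%:E * nu `^ p'^-1)%E ->
     ~ (exists y : R -> R, positive_bvp_solution p c h f y)) /\
  (nu = +oo%E ->
   forall c : R, h 0 < c ->
     ~ (exists y : R -> R, positive_bvp_solution p c h f y)).
Proof.
move=> p' nu.
have p'1 : 1 < p' by exact: conjugate_exponent_gt1.
have p'0 : 0 < p' by lra.
pose A := p' `^ p'^-1 * p `^ p^-1.
have A0 : 0 < A by rewrite mulr_gt0// powR_gt0//; lra.
have nonexistence (c : R) : ((h 0)%:E < c%:E)%E ->
    (c%:E < (h 0)%:E + A%:E * nu `^ p'^-1)%E ->
    ~ (exists y : R -> R, positive_bvp_solution p c h f y).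
  rewrite lte_fin => hc; rewrite addeC -lteBlDr// -EFinB => cA [y sol].
  have [|m [m0 mnu cm]] := exists_subcritical_weight p'0 A0 _ nu_gt0 cA.
    by rewrite subr_ge0 ltW.
  pose K := (c - h 0 + A * m `^ p'^-1) / 2.
  have [cK KA] : c - h 0 < K /\ K < A * m `^ p'^-1 by split; rewrite midf_lt.
  have hK : \forall t \near 0^'+, c - h t <= K.
    have e0 : 0 < K - (c - h 0) by rewrite subr_gt0.
    move/cvgrPdist_lt : h_cont0 => /(_ _ e0); apply: filterS => t.
    by move/ltr_normlW; lra.
  have [d /= d0 near_d] := filterI hK (liminf0_lb mnu).
  have near_min t : 0 < t < Num.min d 1 ->
      c - h t <= K /\ m * t `^ (p' - 1) <= f t.
    rewrite lt_min => /and3P[t0 td _]; apply: near_d => //=.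
    by rewrite sub0r normrN gtr0_norm.
  apply: (no_positive_solution_near0 (delta := Num.min d 1)
    p_gt1 m0 KA _ _ _ _ sol).
  - by rewrite lt_min d0 ltr01.
  - by rewrite ge_min lexx orbT.
  - by move=> t /near_min[].
  - by move=> t /near_min[].
split=> // nuoo c hc; apply: nonexistence; first by rewrite lte_fin.
by rewrite nuoo poweRE gt_eqF ?invr_gt0// eqxx gt0_muley ?lte_fin// addey// ltry.
Qed.
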